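(* If $G$ is a finite abelian group, then $\mathrm{diam}(\mathcal I(G))\in\{1,2,3,4,\infty\}$.
   Context: For a finite group $G$, the inclusion graph of subgroups $\mathcal I(G)$ is the simple graph whose vertices are the proper subgroups of $G$, where ''proper'' means different from both the trivial subgroup and $G$ itself; two distinct vertices $H,K$ are adjacent if and only if $H\subset K$ or $K\subset H$. Graphs are understood to have a nonempty vertex set, so $G$ is assumed to have at least one subgroup different from $\{e\}$ and $G$. The diameter of a connected graph is the maximum, over pairs of vertices, of the length of a shortest path joining them; the diameter of a disconnected graph is $\infty$.
   Formalization: When G has exactly one proper nontrivial subgroup (G cyclic of order p^2), the graph is a single vertex of diameter 0, which is not in {1,2,3,4,∞}; the formal statement asserts diameter 0 in that case and the stated claim in all others. *)

(* Defs.v *)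
From mathcomp Require Import all_boot all_fingroup.
Set Implicit Arguments.
Unset Strict Implicit.
Unset Printing Implicit Defensive.

Section GraphDistance.
Variables (T : finType) (e : rel T).

(** The uniqueness condition is what makes the [e]-walk [x :: p] a path in the
    graph-theoretic sense. *)
Definition has_path (x y : T) (n : nat) : bool :=
  [exists p : n.-tuple T,
     [&& path e x p, last x p == y & uniq (x :: p)]].

(** A path has fewer than [#|T|] edges, so that the search below is exhaustive.
    The result is meaningful only when [y] is reachable from [x]. *)
Definition gdist (x y : T) : nat := find (has_path x y) (iota 0 #|T|).

(** [None] stands for an infinite diameter; a graph with no vertex gets the
    junk value [Some 0]. *)
Definition gdiam : option nat :=
  if [forall x, forall y, connect e x y]
  then Some (\max_(x : T) \max_(y : T) gdist x y)
  else None.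

Lemma has_pathP x y n :
  reflect (exists p, [/\ path e x p, last x p = y, uniq (x :: p) & size p = n])
          (has_path x y n).
Proof.
apply: (iffP existsP) => [[p /and3P[ep /eqP lp up]]|[p [ep lp up /eqP sp]]].
  by exists p; rewrite size_tuple.
by exists (Tuple sp); rewrite ep lp eqxx.
Qed.

Lemma gdist_path x y : connect e x y -> has_path x y (gdist x y).
Proof.
case/connectP=> q eq ->; case/shortenP: eq => p ep up _.
have sp : size p < #|T|.
  by have := max_card [in x :: p]; rewrite (card_uniqP up).
have xp : has_path x (last x p) (size p) by apply/has_pathP; exists p.
have hp : has (has_path x (last x p)) (iota 0 #|T|).
  by apply/hasP; exists (size p); rewrite ?mem_iota //; exact: xp.
have := nth_find 0 hp; rewrite nth_iota //.
by rewrite -[X in _ < X](size_iota 0) -has_find.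
Qed.

Lemma gdist_min x y n : has_path x y n -> gdist x y <= n.
Proof.
move=> hp; rewrite leqNgt; apply/negP => lt_n.
have lt_nT : n < #|T|.
  by apply: leq_trans lt_n _; rewrite -[X in _ <= X](size_iota 0) find_size.
by have := before_find 0 lt_n; rewrite nth_iota // hp.
Qed.

End GraphDistance.

Section InclusionGraph.
Variables (gT : finGroupType) (G : {group gT}).

Definition proper_nontrivial : pred {group gT} :=
  [pred H : {group gT} | (H :!=: 1%g) && (H \proper G)].

(** Pitfall: for [G] cyclic of order [p ^ 2] this type has a single element, so
    that the inclusion graph has diameter 0. *)
Definition incl_vertex : finType := {H : {group gT} | proper_nontrivial H}.

Definition incl_adj : rel incl_vertex :=
  [rel H K : incl_vertex |
    (H != K) && ((val H \subset val K) || (val K \subset val H))].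

Lemma incl_adj_sym : symmetric incl_adj.
Proof. by move=> H K; rewrite /incl_adj /= eq_sym orbC. Qed.

Lemma incl_adj_irr : irreflexive incl_adj.
Proof. by move=> H; rewrite /incl_adj /= eqxx. Qed.

End InclusionGraph.

Arguments incl_adj {gT} G.

(* Main.v *)
Require Import Defs.
From mathcomp Require Import all_boot all_fingroup.

(** Let [H] and [K] be vertices, and let [M <= H] and [N <= K] be minimal
    nontrivial subgroups.  Since [G] is abelian, [M * N] is a subgroup.

    If [M * N] is proper, then [H, M, M * N, N, K] becomes a walk of length at
    most 4 once its consecutive repetitions are deleted
    ([exists_walk_of_lazy]), and the distance from [H] to [K] is at most 4.

    If [M * N = G], then either [M = N], which is impossible because [M] is
    proper, or [M] and [N] are distinct.  In the latter case [M] is isolated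
    ([minimal_factor_isolated]): no vertex is properly below it, and Dedekind's
    modular law leaves no room for a vertex between [M] and [M * N], by
    minimality of [N].  As [N] is another vertex, the graph is disconnected.

    So a connected inclusion graph has diameter at most 4, and the diameter is
    positive as soon as there are two vertices. *)

Section GraphDistance.
Set Implicit Arguments.
Unset Strict Implicit.
Variables (T : finType) (e : rel T).

(** Removing the loops of a walk leaves a path whose vertices are distinct and
    all belong to the walk, so that the path is no longer than the walk. *)
Lemma gdist_walk (x : T) (p : seq T) :
  path e x p -> gdist e x (last x p) <= size p.
Proof.
case/shortenP=> q eq uq sqp.
apply: (@leq_trans (size q)); last first.
  by apply: uniq_leq_size => //; case/andP: uq.
by apply: gdist_min; apply/has_pathP; exists q.
Qed.

(** A lazy walk may stay in place.  With such steps, one sequence of vertices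
    serves a whole family of configurations, whichever of its consecutive
    vertices happen to coincide. *)
Lemma exists_walk_of_lazy (x : T) (p : seq T) :
  path (fun u v => (u == v) || e u v) x p ->
  exists q, [/\ path e x q, last x q = last x p & size q <= size p].
Proof.
elim: p x => [|y p IHp] x /=; first by exists [::].
case/andP=> /orP[/eqP <-|exy] /IHp[q [eq lq sq]].
  by exists q; split=> //; apply: leqW.
by exists (y :: q); rewrite /= exy.
Qed.

Lemma gdist_lazy_walk (x : T) (p : seq T) :
  path (fun u v => (u == v) || e u v) x p ->
  gdist e x (last x p) <= size p.
Proof.
by case/exists_walk_of_lazy=> q [/gdist_walk dq <- sq]; apply: leq_trans sq.
Qed.

Lemma gdistxx (x : T) : gdist e x x = 0.
Proof. by apply/eqP; rewrite -leqn0; apply: (@gdist_walk x [::]). Qed.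

Lemma gdist_gt0 (x y : T) : connect e x y -> x != y -> 0 < gdist e x y.
Proof.
move=> cxy; apply: contraNltn; rewrite leqn0 => /eqP d0.
have /has_pathP[p [_ lp _]] := gdist_path cxy.
by rewrite d0 -lp => /size0nil->.
Qed.

Lemma gdiam_card_le1 : #|T| <= 1 -> gdiam e = Some 0.
Proof.
move/fintype_le1P=> T1; rewrite /gdiam ifT.
  congr Some; apply: big1 => x _; apply: big1 => y _.
  by rewrite (T1 x y) gdistxx.
by apply/forallP=> x; apply/forallP=> y; rewrite (T1 x y) connect0.
Qed.

Lemma gdiam_bounded (n : nat) :
    1 < #|T| ->
    ((forall x y, connect e x y) -> forall x y, gdist e x y <= n) ->
  gdiam e = None \/ exists2 d, 0 < d <= n & gdiam e = Some d.
Proof.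
move=> /card_gt1P[x [y [_ _ xy]]] dn; rewrite /gdiam.
case: ifP => [/'forall_forallP cT|_]; [right | by left].
eexists; last by [].
apply/andP; split.
  apply: leq_trans (gdist_gt0 (cT x y) xy) _.
  exact: leq_trans (leq_bigmax y) (leq_bigmax x).
by apply/bigmax_leqP=> u _; apply/bigmax_leqP=> v _; apply: dn.
Qed.

Lemma isolated_connect (x y : T) :
  (forall z, ~~ e x z) -> connect e x y -> x = y.
Proof.
by move=> ex /connectP[[|z p] //= /andP[exz _] _]; case/negP: (ex z).
Qed.

End GraphDistance.

Section InclusionGraph.
Set Implicit Arguments.
Unset Strict Implicit.
Local Open Scope group_scope.
Variables (gT : finGroupType) (G : {group gT}).
Implicit Types H K L : incl_vertex G.

Lemma vertex_neq1 H : val H :!=: 1.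
Proof. by case/andP: (valP H). Qed.

Lemma vertex_proper H : val H \proper G.
Proof. by case/andP: (valP H). Qed.

Lemma lazy_adj H K :
  (val H \subset val K) || (val K \subset val H) ->
  (H == K) || incl_adj G H K.
Proof. by rewrite /incl_adj /=; case: eqP. Qed.

Lemma exists_minimal_vertex H :
  exists2 M : incl_vertex G,
    val M \subset val H & [min val M of A | A :!=: 1].
Proof.
have [M minM sMH] := @mingroup_exists _ (fun A => A :!=: 1) _ (vertex_neq1 H).
have vM : proper_nontrivial G M.
  apply/andP; split; first exact: mingroupp minM.
  exact: sub_proper_trans sMH (vertex_proper H).
by exists (Sub M vM : incl_vertex G); rewrite SubK.
Qed.

Lemma minimal_subgroup (M H : {group gT}) :
  [min M of A | A :!=: 1] -> H \subset M -> H :=: 1 \/ H :=: M.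
Proof.
move=> /mingroupP[_ minM] sHM.
by case: (eqVneq (H : {set gT}) 1) => [|ntH]; [left | right; apply: minM].
Qed.

(** A subgroup [L] containing [M] is [M * (L :&: N)] by Dedekind's modular law,
    and [L :&: N] is trivial or [N] by minimality of [N]. *)
Lemma minimal_factor_isolated (M N : incl_vertex G) :
    [min val M of A | A :!=: 1] -> [min val N of A | A :!=: 1] ->
    (val M * val N = G) ->
  forall L, ~~ incl_adj G M L.
Proof.
move=> minM minN MN L; apply/negP=> /andP[neML] /orP[sML | sLM].
  have LE : (val M * (val L :&: val N) = val L).
    rewrite setIC group_modl // MN; apply/setIidPr.
    exact: proper_sub (vertex_proper L).
  have [LN|LN] := @minimal_subgroup _ (val L :&: val N)%G minN (subsetIr _ _).
    case/eqP: neML; do 2 apply: val_inj => /=.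
    by rewrite -LE LN mulg1.
  by have := vertex_proper L; rewrite -LE LN MN properxx.
have [L1|LM] := minimal_subgroup minM sLM.
  by have := vertex_neq1 L; rewrite L1 eqxx.
by case/eqP: neML; do 2 apply: val_inj; rewrite /= LM.
Qed.

(** Once the lazy walk through [M <*> N] is excluded, [M * N = G], and an
    isolated [M] can only be connected to [N] by being equal to it. *)
Lemma gdist_incl_le4 :
    abelian G -> (forall H K, connect (incl_adj G) H K) ->
  forall H K, gdist (incl_adj G) H K <= 4.
Proof.
move=> abelG conn H K.
have [M sMH minM] := exists_minimal_vertex H.
have [N sNK minN] := exists_minimal_vertex K.
have sMG := proper_sub (vertex_proper M).
have sNG := proper_sub (vertex_proper N).
have MN : (val M <*> val N = val M * val N).
  by apply: comm_joingE; apply/normC/cents_norm/(centSS sMG sNG).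
case: (boolP (val M <*> val N \proper G)) => [prMN|].
  have vP : proper_nontrivial G (val M <*> val N)%G.
    apply/andP; split=> //; apply: contraNneq (vertex_neq1 M) => P1.
    by rewrite -subG1 -P1 joing_subl.
  pose P : incl_vertex G := Sub (val M <*> val N)%G vP.
  apply: (@gdist_lazy_walk _ _ H [:: M; P; N; K]); rewrite /= !lazy_adj //=.
  - by rewrite sNK.
  - by rewrite joing_subr orbT.
  - by rewrite joing_subl.
  - by rewrite sMH orbT.
rewrite properE join_subG sMG sNG /= negbK => sGMN.
have MNG : (val M * val N = G).
  by apply/eqP; rewrite -MN eqEsubset sGMN join_subG sMG sNG.
have eMN : M = N.
  exact: isolated_connect (minimal_factor_isolated minM minN MNG) (conn M N).
by have := vertex_proper M; rewrite -MNG -eMN mulGid properxx.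
Qed.

End InclusionGraph.

Theorem theorem2p11 (gT : finGroupType) (G : {group gT})
    (abelG : abelian G) (vertexG : 0 < #|incl_vertex G|) :
  (#|incl_vertex G| = 1 /\ gdiam (incl_adj G) = Some 0) \/
  gdiam (incl_adj G) \in [:: Some 1; Some 2; Some 3; Some 4; None].
Proof.
case: (leqP #|incl_vertex G| 1) => [V1 | V2]; [left | right].
  by split; [apply/eqP; rewrite eqn_leq V1 | apply: gdiam_card_le1].
have [-> //|[d d4 ->]] := gdiam_bounded V2 (gdist_incl_le4 abelG).
by case: d d4 => [|[|[|[|[|]]]]].
Qed.
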